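(* Let $p$ be a prime number and $d,e\ge 1$ integers. With respect to the Haar measures on $P_d(\mathbf{Z}_p)$ and $P_e(\mathbf{Z}_p)$, the probability that two random monic polynomials $f\in P_d(\mathbf{Z}_p)$ and $g\in P_e(\mathbf{Z}_p)$ are strongly coprime is $1-p^{-1}$; that is, $$\left(\mu^d_{\mathrm{Haar}}\times\mu^e_{\mathrm{Haar}}\right)\left(\{(f,g)\in P_d(\mathbf{Z}_p)\times P_e(\mathbf{Z}_p) : f \text{ and } g \text{ are strongly coprime}\}\right)=1-p^{-1}.$$
   Context: $\mathbf{Z}_p=\varprojlim \mathbf{Z}/p^k\mathbf{Z}$ is the ring of $p$-adic integers. For a commutative ring $R$, two polynomials $f,g\in R[x]$ are called strongly coprime if $(f,g)=R[x]$, i.e. the ideal of $R[x]$ generated by $f$ and $g$ is all of $R[x]$. For $n\ge1$, $P_n(\mathbf{Z}_p)$ denotes the set of monic polynomials of degree $n$ over $\mathbf{Z}_p$, identified with $\mathbf{Z}_p^n$ by sending $x^n+a_{n-1}x^{n-1}+\cdots+a_0$ to $(a_0,\ldots,a_{n-1})$. $\mu_{\mathrm{Haar}}$ is the unique Haar measure on $\mathbf{Z}_p$ of total mass $1$, and $\mu^n_{\mathrm{Haar}}$ is the resulting product measure on $P_n(\mathbf{Z}_p)=\mathbf{Z}_p^n$. Pairs are measured by the product measure $\mu^d_{\mathrm{Haar}}\times\mu^e_{\mathrm{Haar}}$ on $P_d(\mathbf{Z}_p)\times P_e(\mathbf{Z}_p)$. *)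

(* Defs.v *)
From HB Require Import structures.
From mathcomp Require Import all_boot all_order all_algebra.
From mathcomp Require Import all_classical all_reals all_analysis.
Set Implicit Arguments.
Unset Strict Implicit.
Unset Printing Implicit Defensive.
Import Order.TTheory GRing.Theory Num.Theory.
Local Open Scope classical_set_scope.
Local Open Scope ring_scope.

(* The limit is taken over the exponents k + 1 with k : nat; leaving out the
   trivial ring Z/p^0 does not change it, whereas 'Z_(p ^ 0) is Z/2 in MathComp.
   The definitions make sense for every p : nat, but padic_int p is the ring of
   p-adic integers only for p > 1. *)
Definition padic_red (p k : nat) (x : 'Z_(p ^ k.+2)) : 'Z_(p ^ k.+1) :=
  (x : nat)%:R.

Record padic_int (p : nat) := PadicInt {
  padic_coord : forall k : nat, 'Z_(p ^ k.+1) ;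
  padic_coordP : forall k, padic_red (padic_coord k.+1) = padic_coord k }.

Section PadicRing.
Variable p : nat.
Local Notation Zp := (padic_int p).

HB.instance Definition _ := gen_eqMixin Zp.
HB.instance Definition _ := gen_choiceMixin Zp.

Lemma padic_int_eq (x y : Zp) :
  (forall k, padic_coord x k = padic_coord y k) -> x = y.
Proof.
case: x y => [x px] [y py] /= xy.
have {}xy : x = y by apply: functional_extensionality_dep.
by case: y / xy py => py; congr PadicInt; exact: Prop_irrelevance.
Qed.

Lemma Zp_trunc_dvd k :
  ((Zp_trunc (p ^ k.+1)).+2 %| (Zp_trunc (p ^ k.+2)).+2)%N.
Proof.
case: p => [|[|q]]; first by rewrite !exp0n.
  by rewrite !exp1n.
by rewrite !Zp_cast ?dvdn_exp2l // -[1%N](expn0 q.+2) ltn_exp2l.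
Qed.

Lemma natr_modZ k n :
  (n %% (Zp_trunc (p ^ k.+2)).+2)%N%:R = n%:R :> 'Z_(p ^ k.+1).
Proof.
by apply: val_inj; rewrite /= !Zp_nat /= modn_dvdm // Zp_trunc_dvd.
Qed.

Lemma padic_red0 k : padic_red (0 : 'Z_(p ^ k.+2)) = 0.
Proof. by []. Qed.

Lemma padic_red1 k : padic_red (1 : 'Z_(p ^ k.+2)) = 1.
Proof. by rewrite /padic_red /= natr_modZ. Qed.

Lemma padic_redD k : {morph @padic_red p k : x y / x + y}.
Proof. by move=> x y; rewrite /padic_red /= natr_modZ natrD. Qed.

Lemma padic_redM k : {morph @padic_red p k : x y / x * y}.
Proof. by move=> x y; rewrite /padic_red /= natr_modZ natrM. Qed.

Lemma padic_redN k : {morph @padic_red p k : x / - x}.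
Proof.
move=> x; apply/eqP; rewrite -addr_eq0 -padic_redD addNr padic_red0 //.
Qed.

Definition padic_zero : Zp := PadicInt (@padic_red0).
Definition padic_one : Zp := PadicInt (@padic_red1).

Definition padic_add (x y : Zp) : Zp.
Proof.
exists (fun k => padic_coord x k + padic_coord y k).
by move=> k; rewrite padic_redD !padic_coordP.
Defined.

Definition padic_opp (x : Zp) : Zp.
Proof.
exists (fun k => - padic_coord x k).
by move=> k; rewrite padic_redN padic_coordP.
Defined.

Definition padic_mul (x y : Zp) : Zp.
Proof.
exists (fun k => padic_coord x k * padic_coord y k).
by move=> k; rewrite padic_redM !padic_coordP.
Defined.

Lemma padic_addA : associative padic_add.
Proof. by move=> x y z; apply: padic_int_eq => k /=; rewrite addrA. Qed.

Lemma padic_addC : commutative padic_add.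
Proof. by move=> x y; apply: padic_int_eq => k /=; rewrite addrC. Qed.

Lemma padic_add0 : left_id padic_zero padic_add.
Proof. by move=> x; apply: padic_int_eq => k /=; rewrite add0r. Qed.

Lemma padic_addN : left_inverse padic_zero padic_opp padic_add.
Proof. by move=> x; apply: padic_int_eq => k /=; rewrite addNr. Qed.

HB.instance Definition _ :=
  GRing.isZmodule.Build Zp padic_addA padic_addC padic_add0 padic_addN.

Lemma padic_mulA : associative padic_mul.
Proof. by move=> x y z; apply: padic_int_eq => k /=; rewrite mulrA. Qed.

Lemma padic_mulC : commutative padic_mul.
Proof. by move=> x y; apply: padic_int_eq => k /=; rewrite mulrC. Qed.

Lemma padic_mul1 : left_id padic_one padic_mul.
Proof. by move=> x; apply: padic_int_eq => k /=; rewrite mul1r. Qed.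

Lemma padic_mulDl : left_distributive padic_mul padic_add.
Proof. by move=> x y z; apply: padic_int_eq => k /=; rewrite mulrDl. Qed.

Lemma padic_1neq0 : padic_one != padic_zero.
Proof.
apply/eqP => /(congr1 (fun x => padic_coord x 0%N)) /= /eqP.
by rewrite oner_eq0.
Qed.

HB.instance Definition _ := GRing.Zmodule_isComNzRing.Build Zp
  padic_mulA padic_mulC padic_mul1 padic_mulDl padic_1neq0.

End PadicRing.

Section PadicBorel.
Variable p : nat.
Local Notation Zp := (padic_int p).

(* Inverse limit topology: each Z/p^(k+1) is discrete. *)
Definition padic_embed (x : Zp) :
  prod_topology (fun k => discrete_topology 'Z_(p ^ k.+1)) := padic_coord x.

HB.instance Definition _ := Topological.copy Zp (initial_topology padic_embed).
HB.instance Definition _ := isPointed.Build Zp 0.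

HB.instance Definition _ := @isMeasurable.Build
  (sigma_display (@open Zp)) Zp <<s @open Zp >>
  (@sigma_algebra0 _ setT _) (@sigma_algebraC _ _)
  (@sigma_algebra_bigcup _ setT _).

End PadicBorel.

(* The total mass 1 is part of the type of mu. Regularity is omitted, since
   finite Borel measures on the compact metrizable space Z_p are regular. *)
Definition is_haar (R : realType) (p : nat) (mu : probability (padic_int p) R) :=
  forall (a : padic_int p) (A : set (padic_int p)),
    measurable A -> mu [set a + x | x in A] = mu A.

Section PowerMeasure.
Context d (T : measurableType d) (R : realType).

Definition tuple_cons n (x : T * n.-tuple T) : n.+1.-tuple T :=
  [the n.+1.-tuple T of x.1 :: x.2].

Lemma measurable_tuple_cons n : measurable_fun setT (@tuple_cons n).
Proof. exact: measurable_cons. Qed.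

HB.instance Definition _ n :=
  isMeasurableFun.Build _ _ _ _ (@tuple_cons n) (@measurable_tuple_cons n).

Fixpoint power_measure (mu : probability T R) (n : nat) :
    probability (n.-tuple T) R :=
  if n is m.+1 then distribution (mu \x power_measure mu m)%E (@tuple_cons m)
  else dirac [tuple].

Lemma power_measure_box (mu : probability T R) n (A : 'I_n -> set T) :
  (forall i, measurable (A i)) ->
  power_measure mu n [set t | forall i, A i (tnth t i)]
    = (\prod_(i < n) mu (A i))%E.
Proof.
elim: n A => [|n IHn] A mA.
  rewrite big_ord0 /= diracE mem_set //= => i; by case: i.
have mB : measurable [set t : n.-tuple T | forall i, A (lift ord0 i) (tnth t i)].
  rewrite (_ : [set _ | _] =
      \bigcap_(i in [set: 'I_n]) ((fun t => tnth t i) @^-1` A (lift ord0 i))).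
    apply: fin_bigcap_measurable => // i _.
    by rewrite -[X in measurable X]setTI; exact: measurable_tnth.
  by apply/seteqP; split => [t At i _|t At i]; [exact: At|exact: At].
rewrite big_ord_recl -IHn // -product_measure1E //.
rewrite /= /distribution /pushforward; congr (product_measure1 _ _ _).
apply/seteqP; split => -[x t] /=.
  move=> At; split; first exact: (At ord0).
  by move=> i; have := At (lift ord0 i); rewrite tnthS.
case=> Ax At i; have [j ->|->] := unliftP ord0 i; last by [].
by rewrite tnthS; exact: At.
Qed.

End PowerMeasure.

Definition monic_of_coefs (A : nzRingType) n (a : n.-tuple A) : {poly A} :=
  'X^n + \sum_(i < n) tnth a i *: 'X^i.

Lemma coef_monic_of_coefs (A : nzRingType) n (a : n.-tuple A) (i : 'I_n) :
  (monic_of_coefs a)`_i = tnth a i.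
Proof.
rewrite coefD coefXn (ltn_eqF (ltn_ord i)) add0r coef_sum (bigD1 i) //=.
rewrite coefZ coefXn eqxx mulr1 big1 ?addr0 // => j ji.
by rewrite coefZ coefXn eq_sym (inj_eq val_inj) (negbTE ji) mulr0.
Qed.

Lemma monic_of_coefs_inj (A : nzRingType) n : injective (@monic_of_coefs A n).
Proof.
by move=> a b ab; apply: eq_from_tnth => i; rewrite -!coef_monic_of_coefs ab.
Qed.

Lemma range_monic_of_coefs (A : nzRingType) n :
  range (@monic_of_coefs A n) =
  [set f : {poly A} | f \is monic /\ size f = n.+1].
Proof.
apply/seteqP; split => [_ [a _ <-]|f [/monicP f1 sf]] /=.
  have sa : (size (\sum_(i < n) tnth a i *: 'X^i)%R < size ('X^n : {poly A})%R)%N.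
    rewrite size_polyXn ltnS; apply: (leq_trans (size_sum _ _ _)).
    apply/bigmax_leqP => i _; apply: (leq_trans (size_scale_leq _ _)).
    by rewrite size_polyXn.
  by rewrite size_polyDl // size_polyXn monicE lead_coefDl // lead_coefXn.
exists [tuple f`_i | i < n] => //; apply/polyP => i.
have [lt_in|le_ni] := ltnP i n.
  by rewrite (coef_monic_of_coefs _ (Ordinal lt_in)) tnth_mktuple.
rewrite coefD coefXn coef_sum big1 ?addr0 => [|j _]; last first.
  by rewrite coefZ coefXn gtn_eqF ?mulr0 // (leq_trans (ltn_ord j)).
have [->|ni] := eqVneq i n; first by rewrite -f1 lead_coefE sf.
by rewrite nth_default // sf ltn_neqAle eq_sym ni.
Qed.

Definition ideal2 (A : comNzRingType) (f g : A) : set A :=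
  [set h | exists u v : A, h = u * f + v * g].

Definition strongly_coprime (A : comNzRingType) (f g : {poly A}) : Prop :=
  ideal2 f g = [set: {poly A}].

Definition strongly_coprime_pairs (p d e : nat) :
    set (d.-tuple (padic_int p) * e.-tuple (padic_int p)) :=
  [set ab | strongly_coprime (monic_of_coefs ab.1) (monic_of_coefs ab.2)].
Arguments strongly_coprime_pairs : clear implicits.

(* Main.v *)
From HB Require Import structures.
Require Import Defs.
From mathcomp Require Import all_boot all_order all_algebra.
From mathcomp Require Import all_classical all_reals all_analysis.
Set Implicit Arguments.
Unset Strict Implicit.
Unset Printing Implicit Defensive.
Import Order.TTheory GRing.Theory Num.Theory.
Local Open Scope classical_set_scope.
Local Open Scope ring_scope.

(** Strong coprimality over Z_p is seen modulo p.  For monic f and g the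
    resultant lies in the ideal (f, g) and commutes with reduction, and an
    element of Z_p whose residue is nonzero is a unit; so (f, g) is the whole
    of Z_p[x] as soon as the reductions of f and g are coprime over F_p, the
    converse being the reduction of a Bezout identity
    ([strongly_coprime_residue]).

    The set to be measured is therefore a finite disjoint union of residue
    boxes.  By translation invariance the p residue classes of Z_p have the
    same measure, hence measure 1/p ([haar_residue_fibre]), and each box of
    P_d x P_e has measure p^-(d+e) ([product_power_measure_fibre]).

    It remains to count the coprime pairs of monic polynomials of degrees d
    and e over a field with q elements ([card_coprime_coefs]).  Every pair of
    monic polynomials is (h u, h v) for unique monic h, u, v with u and v
    coprime.  Replacing h by h X + c, with c a constant, raises both degrees
    by one, and h X + c runs through each nonconstant monic polynomial once.
    So this is a bijection from F x P_(d-1) x P_(e-1) onto the pairs of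
    P_d x P_e that are not coprime.  There are q^(d+e-1) of these among
    q^(d+e) pairs: a proportion of 1/q. *)

(** * Coprime pairs of monic polynomials over a finite field *)

Lemma monic_of_coefsP (A : nzRingType) n (a : n.-tuple A) :
  monic_of_coefs a \is monic /\ size (monic_of_coefs a) = n.+1.
Proof.
have : range (@monic_of_coefs A n) (monic_of_coefs a) by exists a.
by rewrite range_monic_of_coefs.
Qed.

Definition monic_gcd (F : fieldType) (f g : {poly F}) : {poly F} :=
  (lead_coef (gcdp f g))^-1 *: gcdp f g.

Lemma monic_gcd_monic (F : fieldType) (f g : {poly F}) :
  f \is monic -> monic_gcd f g \is monic.
Proof.
move=> /monic_neq0 f0; rewrite monicE lead_coefZ mulVf //.
by rewrite lead_coef_eq0 gcdp_eq0 (negbTE f0).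
Qed.

Lemma eqp_monic_gcd (F : fieldType) (f g : {poly F}) :
  f \is monic -> monic_gcd f g %= gcdp f g.
Proof.
move=> /monic_neq0 f0; apply: eqp_scale.
by rewrite invr_eq0 lead_coef_eq0 gcdp_eq0 (negbTE f0).
Qed.

Lemma monic_gcdM (F : fieldType) (h u v : {poly F}) :
  h \is monic -> u \is monic -> coprimep u v ->
  monic_gcd (h * u) (h * v) = h.
Proof.
move=> hm um cuv; have hum : h * u \is monic by rewrite monicMr.
apply/eqP; rewrite -eqp_monic ?monic_gcd_monic //.
apply: (eqp_trans (eqp_monic_gcd _ hum)).
rewrite eqp_sym; apply: eqp_trans (mulp_gcdr _ _ _).
by rewrite -[X in X %= _]mulr1 eqp_mul2l ?monic_neq0 // eqp_sym gcdp_eqp1.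
Qed.

(** The decomposition on which the count rests; [monic_gcdM] says that [h] is
    determined by the pair, hence so are [u] and [v]. *)
Lemma monic_gcd_factor (F : fieldType) (f g : {poly F}) :
  f \is monic -> g \is monic ->
  exists h u v : {poly F},
    [/\ [/\ h \is monic, u \is monic & v \is monic],
        coprimep u v, f = h * u & g = h * v].
Proof.
move=> fm gm; have hm := monic_gcd_monic g fm.
have hE := eqp_monic_gcd g fm; set h := monic_gcd f g in hm hE *.
have fE : f = h * (f %/ h).
  by rewrite mulrC divpK // (eqp_dvdl _ hE) dvdp_gcdl.
have gE : g = h * (g %/ h).
  by rewrite mulrC divpK // (eqp_dvdl _ hE) dvdp_gcdr.
exists h, (f %/ h), (g %/ h); split => //.
  by split=> //; [rewrite -(monicMr _ hm) mulrC -fE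
                 |rewrite -(monicMr _ hm) mulrC -gE].
rewrite (eqp_coprimepl _ (eqp_divr _ hE)) (eqp_coprimepr _ (eqp_divr _ hE)).
by rewrite coprimep_div_gcd // monic_neq0.
Qed.

(** The map (h u, h v) |-> ((h X + c) u, (h X + c) v), where h is the gcd. *)
Definition shift_pair (F : fieldType) (c : F) (fg : {poly F} * {poly F}) :=
  let h := monic_gcd fg.1 fg.2 in
  ((h * 'X + c%:P) * (fg.1 %/ h), (h * 'X + c%:P) * (fg.2 %/ h)).

Lemma shift_pairM (F : fieldType) (c : F) (h u v : {poly F}) :
  h \is monic -> u \is monic -> coprimep u v ->
  shift_pair c (h * u, h * v) =
    ((h * 'X + c%:P) * u, (h * 'X + c%:P) * v).
Proof.
move=> hm um cuv; rewrite /shift_pair /= monic_gcdM //.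
by rewrite ![h * _]mulrC !mulpK ?monic_neq0 // mulrC.
Qed.

Lemma size_MXaddC_monic (F : fieldType) (c : F) (h : {poly F}) :
  h \is monic -> size (h * 'X + c%:P) = (size h).+1.
Proof. by move=> hm; rewrite size_MXaddC (negbTE (monic_neq0 hm)). Qed.

Lemma monic_MXaddC (F : fieldType) (c : F) (h : {poly F}) :
  h \is monic -> h * 'X + c%:P \is monic.
Proof.
move=> hm; rewrite monicE lead_coefE size_MXaddC_monic //= coefD coefMX coefC.
have := monicP hm; rewrite lead_coefE.
have : size h != 0%N by rewrite size_poly_eq0 monic_neq0.
by case: (size h) => [|n] //= _ ->; rewrite addr0.
Qed.

(** The gcd of the image is h X + c, from which c and h can be read off, and
    then u and v by cancellation. *)
Lemma shift_pair_inj (F : fieldType) (c c' : F) (f g f' g' : {poly F}) :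
  f \is monic -> g \is monic -> f' \is monic -> g' \is monic ->
  shift_pair c (f, g) = shift_pair c' (f', g') -> [/\ c = c', f = f' & g = g'].
Proof.
move=> fm gm f'm g'm.
have [h [u [v [[hm um vm] cuv -> ->]]]] := monic_gcd_factor fm gm.
have [h' [u' [v' [[h'm u'm v'm] cuv' -> ->]]]] := monic_gcd_factor f'm g'm.
rewrite !shift_pairM // => - [eu ev].
have eh : h * 'X + c%:P = h' * 'X + c'%:P.
  by rewrite -(monic_gcdM (monic_MXaddC c hm) um cuv) eu ev monic_gcdM
             ?monic_MXaddC.
have ec : c = c'.
  by have := congr1 (fun P : {poly F} => P`_0) eh;
     rewrite !coefD !coefMX !coefC !add0r.
have {}eh' : h = h'.
  by move: eh; rewrite ec => /addIr /(mulIf (monic_neq0 (monicX F))).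
have nz := monic_neq0 (monic_MXaddC c' h'm).
by move: eu ev; rewrite eh => /(mulfI nz) -> /(mulfI nz) ->; rewrite eh'.
Qed.

Lemma shift_pair_monic (F : fieldType) d e (c : F) (f g : {poly F}) :
  f \is monic /\ size f = d.+1 -> g \is monic /\ size g = e.+1 ->
  let FG := shift_pair c (f, g) in
  [/\ FG.1 \is monic /\ size FG.1 = d.+2, FG.2 \is monic /\ size FG.2 = e.+2
    & ~~ coprimep FG.1 FG.2].
Proof.
move=> [fm sf] [gm sg].
have [h [u [v [[hm um vm] cuv ef eg]]]] := monic_gcd_factor fm gm.
have Hm := monic_MXaddC c hm.
move: sf sg; rewrite ef eg shift_pairM //=.
rewrite !size_Mmonic ?monic_neq0 // size_MXaddC_monic // !addSn /=.
have : (0 < size h)%N by rewrite size_poly_gt0 monic_neq0.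
case eh : (size h) => [//|k] _; rewrite !addSn /= => -> ->.
split; [by rewrite monicMr|by rewrite monicMr|].
apply/negP => /coprimepP /(_ (h * 'X + c%:P)).
rewrite !dvdp_mulr // -size_poly_eq1 size_MXaddC_monic // eh.
by move/(_ isT isT).
Qed.

(** The gcd H of a pair that is not coprime is nonconstant, so it is h X + c
    with h monic; dividing both polynomials by H and multiplying them by h
    gives the preimage. *)
Lemma shift_pair_surj (F : fieldType) d e (f g : {poly F}) :
  f \is monic /\ size f = d.+2 -> g \is monic /\ size g = e.+2 ->
  ~~ coprimep f g ->
  exists (c : F) (f' g' : {poly F}),
    [/\ f' \is monic /\ size f' = d.+1, g' \is monic /\ size g' = e.+1
      & shift_pair c (f', g') = (f, g)].
Proof.
move=> [fm sf] [gm sg].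
have [H [u [v [[Hm um vm] cuv ef eg]]]] := monic_gcd_factor fm gm => ncop.
have HE : H = drop_poly 1 H * 'X + (H`_0)%:P.
  apply/polyP => i; rewrite coefD coefMX coefC coef_drop_poly.
  by case: i => [|i] /=; rewrite ?add0r // addr0 addn1.
have sH : (1 < size H)%N.
  rewrite ltn_neqAle eq_sym size_poly_eq1 size_poly_gt0 monic_neq0 // andbT.
  apply: contra ncop; rewrite eqp_monic ?monic1 // => /eqP H1.
  by rewrite ef eg H1 !mul1r.
have hm : drop_poly 1 H \is monic.
  rewrite monicE lead_coefE size_drop_poly coef_drop_poly subn1 addn1.
  by rewrite prednK -?lead_coefE -?monicE // -ltnS prednK ?(ltnW sH).
exists H`_0, (drop_poly 1 H * u), (drop_poly 1 H * v).
rewrite shift_pairM // -HE -ef -eg !monicMr //.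
move: sf sg; rewrite ef eg !size_Mmonic ?monic_neq0 // size_drop_poly.
move: sH; case: (size H) => [//|[//|k]] _.
by rewrite subn1 !addSn /= => -[->] [->].
Qed.

Section CountCoprime.
Variable F : finFieldType.
Implicit Types n d e : nat.

Definition coefs n (f : {poly F}) : n.-tuple F := [tuple f`_i | i < n].

Lemma coefsK n (f : {poly F}) :
  f \is monic /\ size f = n.+1 -> monic_of_coefs (coefs n f) = f.
Proof.
move=> fP; have : range (@monic_of_coefs F n) f by rewrite range_monic_of_coefs.
case=> a _ <-; congr monic_of_coefs; apply: eq_from_tnth => i.
by rewrite tnth_mktuple coef_monic_of_coefs.
Qed.

Definition coprime_coefs d e : {set d.-tuple F * e.-tuple F} :=
  [set ab | coprimep (monic_of_coefs ab.1) (monic_of_coefs ab.2)].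

Definition shift_coefs d e (x : F * (d.-tuple F * e.-tuple F)) :
    d.+1.-tuple F * e.+1.-tuple F :=
  let FG := shift_pair x.1 (monic_of_coefs x.2.1, monic_of_coefs x.2.2) in
  (coefs d.+1 FG.1, coefs e.+1 FG.2).

Lemma shift_coefsE d e (x : F * (d.-tuple F * e.-tuple F)) :
  (monic_of_coefs (shift_coefs x).1, monic_of_coefs (shift_coefs x).2) =
    shift_pair x.1 (monic_of_coefs x.2.1, monic_of_coefs x.2.2).
Proof.
have [m1 m2 _] := shift_pair_monic x.1 (monic_of_coefsP x.2.1)
  (monic_of_coefsP x.2.2).
by rewrite /shift_coefs /= !coefsK // -surjective_pairing.
Qed.

Lemma shift_coefs_inj d e : injective (@shift_coefs d e).
Proof.
move=> [c [a b]] [c' [a' b']] eq_s.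
have := shift_coefsE (c', (a', b')); rewrite -eq_s shift_coefsE /=.
case/shift_pair_inj; try exact: (monic_of_coefsP _).1.
by move=> -> /monic_of_coefs_inj -> /monic_of_coefs_inj ->.
Qed.

Lemma shift_coefs_image d e :
  [set shift_coefs x | x in [set: F * (d.-tuple F * e.-tuple F)]]%SET =
    ~: coprime_coefs d.+1 e.+1.
Proof.
apply/setP => -[a b]; rewrite !inE /=; apply/imsetP/idP.
  case=> -[c [f g]] _ eab; have := shift_coefsE (c, (f, g)); rewrite -eab /=.
  have [_ _] := shift_pair_monic c (monic_of_coefsP f) (monic_of_coefsP g).
  by move=> nc e0; rewrite -e0 in nc.
move=> nc; have [c [f [g [fP gP efg]]]] :=
  shift_pair_surj (monic_of_coefsP a) (monic_of_coefsP b) nc.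
exists (c, (coefs d f, coefs e g)); first by rewrite inE.
have := shift_coefsE (c, (coefs d f, coefs e g)).
case: shift_coefs => a' b'; rewrite /fst /snd !coefsK // efg => -[].
by move=> /monic_of_coefs_inj -> /monic_of_coefs_inj ->.
Qed.

(** The second term on the left counts F x P_d x P_e, which [shift_coefs] maps
    bijectively onto the pairs that are not coprime. *)
Lemma card_coprime_coefs d e :
  (#|coprime_coefs d.+1 e.+1| + #|F| ^ (d + e).+1 = #|F| ^ (d + e).+2)%N.
Proof.
have <- : #|~: coprime_coefs d.+1 e.+1| = (#|F| ^ (d + e).+1)%N.
  rewrite -shift_coefs_image card_imset ?cardsT; last exact: shift_coefs_inj.
  by rewrite !card_prod !card_tuple -expnD -expnS.
by rewrite cardsC card_prod !card_tuple -expnD addSn addnS.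
Qed.

End CountCoprime.

(** * Strong coprimality over a local ring *)

Lemma map_monic_of_coefs (A B : nzRingType) (phi : {rmorphism A -> B}) n
    (a : n.-tuple A) :
  map_poly phi (monic_of_coefs a) = monic_of_coefs (map_tuple phi a).
Proof.
rewrite /monic_of_coefs rmorphD /= map_polyXn rmorph_sum /=; congr (_ + _).
by apply: eq_bigr => i _; rewrite map_polyZ map_polyXn tnth_map.
Qed.

(** Since [f] and [g] are monic, their sizes do not drop under [phi], so the
    Sylvester matrix is mapped entrywise to that of the images. *)
Lemma map_resultant_monic (A B : nzRingType) (phi : {rmorphism A -> B})
    (f g : {poly A}) :
  f \is monic -> g \is monic ->
  phi (resultant f g) = resultant (map_poly phi f) (map_poly phi g).
Proof.
move=> /monicP lf /monicP lg; rewrite /resultant /Sylvester_mx.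
rewrite !size_map_poly_id0 ?lf ?lg ?rmorph1 ?oner_neq0 //.
rewrite -det_map_mx /= map_col_mx; congr (\det (col_mx _ _));
  by apply: map_lin1_mx => v; rewrite map_poly_rV rmorphM /= map_rVpoly.
Qed.

(** The hypothesis on [phi] makes [A] local with maximal ideal the kernel of
    [phi].  The resultant is then a unit of [A] exactly when its image is
    nonzero, which replaces an appeal to Nakayama's lemma for A[x]/(f). *)
Lemma strongly_coprime_residue (A : comNzRingType) (F : fieldType)
    (phi : {rmorphism A -> F}) (f g : {poly A}) :
  (forall x, phi x != 0 -> exists y, y * x = 1) ->
  f \is monic -> g \is monic -> (1 < size f)%N -> (1 < size g)%N ->
  strongly_coprime f g <-> coprimep (map_poly phi f) (map_poly phi g).
Proof.
move=> phi_unit fm gm sf sg; split.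
  move=> fgT; have [u [v uv1]] : ideal2 f g 1 by rewrite fgT.
  apply/Bezout_eq1_coprimepP; exists (map_poly phi u, map_poly phi v) => /=.
  by rewrite -!rmorphM -rmorphD -uv1 rmorph1.
move=> cop; have [y yr] : exists y, y * resultant f g = 1.
  apply: phi_unit; rewrite map_resultant_monic // resultant_eq0.
  by rewrite (eqP cop).
have [[u v] _ /= ruv] := resultant_in_ideal sf sg.
apply/seteqP; split=> // h _; exists (h * y%:P * u), (h * y%:P * v).
by rewrite -!mulrA -!mulrDr -ruv -polyCM yr mulr1.
Qed.

(** * The residue map of the p-adic integers *)

Section PadicResidue.
Variable p : nat.
Local Notation Zp := (padic_int p).

(** Landing in ['F_p] rather than in ['Z_(p ^ 1)], where the coordinate lives,
    gives a codomain with a field structure. *)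
Definition residue (x : Zp) : 'F_p := (padic_coord x 0 : nat)%:R.

Lemma Zp_trunc_pdiv_dvd :
  ((Zp_trunc (pdiv p)).+2 %| (Zp_trunc (p ^ 1)).+2)%N.
Proof.
(* For p <= 1 both moduli are 2. *)
rewrite expn1; have [p_le1|p_gt1] := leqP p 1; first by case: p p_le1 => [|[]].
by rewrite !Zp_cast ?pdiv_dvd // prime_gt1 // pdiv_prime.
Qed.

Lemma natr_modFp n : (n %% (Zp_trunc (p ^ 1)).+2)%N%:R = n%:R :> 'F_p.
Proof.
by apply: val_inj; rewrite /= !Zp_nat /= modn_dvdm // Zp_trunc_pdiv_dvd.
Qed.

Fact residue_is_zmod_morphism : zmod_morphism residue.
Proof.
move=> x y; apply/eqP; rewrite eq_sym subr_eq; apply/eqP.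
by rewrite /residue -natrD -[RHS]natr_modFp -[in LHS](subrK y x).
Qed.

Fact residue_is_monoid_morphism : monoid_morphism residue.
Proof.
split=> [|x y]; first by rewrite /residue /= natr_modFp.
by rewrite /residue /= natr_modFp natrM.
Qed.

HB.instance Definition _ :=
  GRing.isZmodMorphism.Build Zp 'F_p residue residue_is_zmod_morphism.
HB.instance Definition _ :=
  GRing.isMonoidMorphism.Build Zp 'F_p residue residue_is_monoid_morphism.

Lemma residue_natr (a : 'F_p) : residue (a : nat)%:R = a.
Proof. by rewrite rmorph_nat natr_Zp. Qed.

Hypothesis p_prime : prime p.

Lemma padic_coord_mod (x : Zp) k :
  (padic_coord x k : nat) = padic_coord x 0 %[mod p].
Proof.
elim: k => // k <-; rewrite -[padic_coord x k]padic_coordP /padic_red Zp_nat /=.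
rewrite modn_dvdm // Zp_cast ?dvdn_exp //.
by rewrite -[1%N](expn0 p) ltn_exp2l // prime_gt1.
Qed.

Lemma padic_coord_unit (x : Zp) k :
  residue x != 0 -> padic_coord x k \is a GRing.unit.
Proof.
move=> rx; have p_gt1 := prime_gt1 p_prime.
have pk_gt1 : (1 < p ^ k.+1)%N by rewrite -[1%N](expn0 p) ltn_exp2l.
rewrite -[padic_coord x k]natr_Zp unitZpE // coprimeXl //.
rewrite prime_coprime // /dvdn padic_coord_mod -/(dvdn _ _).
by rewrite (dvdn_pcharf (pchar_Fp p_prime)).
Qed.

(** Inverses are taken coordinatewise; they are compatible because inverses in
    Z/p^k are unique. *)
Lemma padic_unit (x : Zp) : residue x != 0 -> exists y, y * x = 1.
Proof.
move=> rx; have xU k := padic_coord_unit k rx.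
have yP k : padic_red (padic_coord x k.+1)^-1 = (padic_coord x k)^-1.
  apply: (mulIr (xU k)); rewrite mulVr ?xU //.
  by rewrite -[padic_coord x k]padic_coordP -padic_redM mulVr ?xU // padic_red1.
by exists (PadicInt yP); apply: padic_int_eq => k /=; rewrite mulVr ?xU.
Qed.

End PadicResidue.

(** * Measure of sets that depend on finitely many classes *)

Section FiniteFibres.
Context d (T : measurableType d) (R : realType) (I : finType) (r : T -> I).
Hypothesis mr : forall i, measurable [set x | r x = i].

Lemma measurable_finite_fibres (S : {set I}) : measurable [set x | r x \in S].
Proof.
rewrite (_ : [set _ | _] = \bigcup_(i in [set` S]) [set x | r x = i]).
  by apply: fin_bigcup_measurable => // i _; exact: mr.
by apply/seteqP; split=> x /=; [exists (r x)|case=> i /= iS ->].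
Qed.

Lemma measure_finite_fibres (mu : {measure set T -> \bar R}) (S : {set I}) :
  mu [set x | r x \in S] = (\sum_(i in S) mu [set x | r x = i])%E.
Proof.
rewrite (_ : [set _ | _] = \bigcup_(i in [set` S]) [set x | r x = i]).
  rewrite measure_fin_bigcup //; last first.
    by move=> i j _ _ [x [/= ri rj]]; rewrite -ri -rj.
  rewrite -big_enum [RHS]fsbig_seq ?enum_uniq //.
  suff -> : [set` enum S] = [set` S] by [].
  by apply/seteqP; split=> i /=; rewrite mem_enum.
by apply/seteqP; split=> x /=; [exists (r x)|case=> i /= iS ->].
Qed.

Lemma fibre_map_tuple n (s : n.-tuple I) :
  [set t : n.-tuple T | map_tuple r t = s] =
  [set t | forall i, [set x | r x = tnth s i] (tnth t i)].
Proof.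
apply/seteqP; split=> t /=; first by move=> <- i; rewrite tnth_map.
by move=> rt; apply: eq_from_tnth => i; rewrite tnth_map.
Qed.

Lemma measurable_fibre_map_tuple n (s : n.-tuple I) :
  measurable [set t : n.-tuple T | map_tuple r t = s].
Proof.
rewrite (_ : [set _ | _] = \bigcap_(i in [set: 'I_n])
    ((fun t => tnth t i) @^-1` [set x | r x = tnth s i])).
  apply: fin_bigcap_measurable => // i _.
  by rewrite -[X in measurable X]setTI; exact: measurable_tnth.
rewrite fibre_map_tuple.
by apply/seteqP; split => [t At i _|t At i]; [exact: At|exact: At].
Qed.

Lemma power_measure_fibre (mu : probability T R) (c : R) n (s : n.-tuple I) :
  (forall i, mu [set x | r x = i] = c%:E) ->
  power_measure mu n [set t | map_tuple r t = s] = (c ^+ n)%:E.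
Proof.
move=> muc; rewrite fibre_map_tuple.
rewrite (@power_measure_box _ _ _ _ _ (fun i => [set x | r x = tnth s i])) //.
rewrite (eq_bigr (fun=> c%:E)) => [|i _]; last exact: muc.
by rewrite prodEFin prodr_const card_ord.
Qed.

Lemma fibre_map_pair m n (st : m.-tuple I * n.-tuple I) :
  [set ab : m.-tuple T * n.-tuple T |
    (map_tuple r ab.1, map_tuple r ab.2) = st] =
  [set a | map_tuple r a = st.1] `*` [set b | map_tuple r b = st.2].
Proof.
case: st => s t; apply/seteqP; split=> -[a b] /=; first by case=> -> ->.
by case=> -> ->.
Qed.

Lemma measurable_fibre_map_pair m n (st : m.-tuple I * n.-tuple I) :
  measurable [set ab : m.-tuple T * n.-tuple T |
    (map_tuple r ab.1, map_tuple r ab.2) = st].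
Proof.
rewrite fibre_map_pair.
by apply: measurableX; exact: measurable_fibre_map_tuple.
Qed.

Lemma product_power_measure_fibre (mu : probability T R) (c : R) m n
    (st : m.-tuple I * n.-tuple I) :
  (forall i, mu [set x | r x = i] = c%:E) ->
  (power_measure mu m \x power_measure mu n)%E
    [set ab | (map_tuple r ab.1, map_tuple r ab.2) = st] = (c ^+ (m + n))%:E.
Proof.
move=> muc; rewrite fibre_map_pair product_measure1E;
  try exact: measurable_fibre_map_tuple.
rewrite exprD EFinM; congr (_ * _)%E; exact: power_measure_fibre.
Qed.

End FiniteFibres.

(** * Haar measure of the residue classes *)

Section HaarResidue.
Variables (R : realType) (p : nat) (mu : probability (padic_int p) R).
Hypothesis p_prime : prime p.
Local Notation Zp := (padic_int p).

(** A residue class is open, as the preimage of a subset of the discrete factor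
    Z/p of the product in which Z_p is embedded. *)
Lemma measurable_residue_fibre (a : 'F_p) :
  measurable [set x : Zp | residue x = a].
Proof.
apply: sub_sigma_algebra.
pose U : set (discrete_topology 'Z_(p ^ 1)) :=
  [set y | (y : nat)%:R = a :> 'F_p].
have oU : open U by exact: discrete_open.
pose pr :=
  proj 0%N : prod_topology (fun k => discrete_topology 'Z_(p ^ k.+1)) -> _.
have cpr : continuous pr by exact: proj_continuous.
have oV : open (pr @^-1` U) by move/continuousP: cpr; exact.
by exists (pr @^-1` U).
Qed.

(** The classes are translates of one another, and they partition a space of
    mass 1 into p parts. *)
Lemma haar_residue_fibre (a : 'F_p) :
  is_haar mu -> mu [set x | residue x = a] = (p%:R^-1)%:E.
Proof.
move=> haar; have mf := measurable_residue_fibre.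
have tr b : mu [set x | residue x = b] = mu [set x | residue x = 0].
  rewrite -[RHS](haar (b : nat)%:R) //; congr (mu _); apply/seteqP.
  split=> x /=; last first.
    by case=> y /= y0 <-; rewrite rmorphD /= residue_natr y0 addr0.
  move=> xb; exists (x - (b : nat)%:R); last by rewrite addrC subrK.
  by rewrite rmorphB /= residue_natr xb subrr.
have fin : mu [set x | residue x = 0] \is a fin_num by exact: fin_num_measure.
have total : [set x : Zp | residue x \in [set: 'F_p]%SET] = setT.
  by apply/seteqP; split=> x //= _; rewrite inE.
have : mu setT = (\sum_(b in [set: 'F_p]%SET) mu [set x | residue x = b])%E.
  by rewrite -total; exact: measure_finite_fibres.
rewrite probability_setT.
rewrite (eq_bigr (fun=> mu [set x | residue x = 0])) => [|b _]; last exact: tr.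
rewrite tr -(fineK fin) sumEFin sumr_const cardsT card_Fp // => -[].
rewrite -[_ *+ p]mulr_natr => e; congr (_%:E).
have p0 : p%:R != 0 :> R by rewrite pnatr_eq0 -lt0n prime_gt0.
by apply: (mulIf p0); rewrite mulVf.
Qed.

End HaarResidue.

(** * The probability of strong coprimality *)

Theorem theorem4 (R : realType) (p d e : nat)
    (mu : probability (padic_int p) R) (p_prime : prime p)
    (d_gt0 : (0 < d)%N) (e_gt0 : (0 < e)%N) (mu_haar : is_haar mu) :
  measurable (strongly_coprime_pairs p d e) /\
  (power_measure mu d \x power_measure mu e)%E (strongly_coprime_pairs p d e)
    = (1 - p%:R^-1)%:E.
Proof.
case: d d_gt0 => // d _; case: e e_gt0 => // e _.
pose r (ab : d.+1.-tuple (padic_int p) * e.+1.-tuple (padic_int p)) :=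
  (map_tuple (@residue p) ab.1, map_tuple (@residue p) ab.2).
have -> : strongly_coprime_pairs p d.+1 e.+1 =
    [set ab | r ab \in coprime_coefs 'F_p d.+1 e.+1].
  rewrite /strongly_coprime_pairs; apply: eq_set => -[a b] /=.
  have [am sa] := monic_of_coefsP a; have [bm sb] := monic_of_coefsP b.
  rewrite inE -!map_monic_of_coefs; apply/propext.
  apply: strongly_coprime_residue; rewrite ?sa ?sb //.
  exact: padic_unit.
have mr st : measurable [set ab | r ab = st].
  exact: (measurable_fibre_map_pair (@measurable_residue_fibre p)).
split; first exact: measurable_finite_fibres.
have p0 : p%:R != 0 :> R by rewrite pnatr_eq0 -lt0n prime_gt0.
have fib := product_power_measure_fibre (@measurable_residue_fibre p) _
  (fun a => haar_residue_fibre p_prime a mu_haar).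
rewrite (measure_finite_fibres mr) (eq_bigr _ (fun st _ => fib _ _ st)).
rewrite sumEFin sumr_const; congr (_%:E).
have cardE : #|coprime_coefs 'F_p d.+1 e.+1|%:R
    = p%:R ^+ (d + e).+2 - p%:R ^+ (d + e).+1 :> R.
  have := card_coprime_coefs 'F_p d e; rewrite card_Fp // => eN.
  by rewrite -!natrX -eN natrD addrK.
rewrite -[LHS]mulr_natl cardE addSn addnS exprVn mulrBl divff ?expf_neq0 //.
by rewrite [p%:R ^+ _.+2]exprS invfM mulrCA mulfV ?expf_neq0 // mulr1.
Qed.
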